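(* Let $f\in\mathcal S_2(\mathbb R^n)$, let $x\in\mathbb R^n\setminus\{0\}$ and let $y=\nabla^\circ f(x)$. If $f^\circ|_{[0,y]}$ is not linear, then $f^\circ$ is twice differentiable at $y$, $\nabla^2 f^\circ(y)>0$, and $$\big(f(x)f^\circ(y)\big)^2(\nabla^2 f^\circ)(y)=\big(f(x)I-x\,\nabla f(x)\big)\,(\nabla^2 f(x))^{-1}\,\big(f^\circ(y)I-(\nabla f^\circ(y)\,y)^T\big),$$ $$(\nabla^2 f^\circ(y))^{-1}=f(x)f^\circ(y)\,(I-xy)^T\,\nabla^2 f(x)\,(I-xy).$$ In particular, $$\det(\nabla^2 f(x))\,\det(\nabla^2 f^\circ(y))=\frac{1}{(f(x)f^\circ(y))^{n+2}}.$$
   Context: $\mathrm{Cvx}_0(\mathbb R^n)$ is the set of convex lower semi-continuous $f:\mathbb R^n\to[0,+\infty]$ with $f(0)=0$; $\mathrm{dom}(f)=\{f<\infty\}$. The polar of $f$ is $f^\circ(y)=\inf\{c\ge0:\langle x,y\rangle\le1+cf(x)\ \forall x\in\mathbb R^n\}$ (with $\inf\emptyset=+\infty$). $\mathcal S_1(\mathbb R^n)$ is the class of $f\in\mathrm{Cvx}_0(\mathbb R^n)$ that are finite everywhere, continuously differentiable on $\mathbb R^n\setminus\{0\}$ and strictly convex (the graph contains no segment). $\mathcal S_2(\mathbb R^n)\subset\mathcal S_1(\mathbb R^n)$ is the subclass of functions that are twice continuously differentiable on $\mathbb R^n\setminus\{0\}$ with positive definite Hessian $\nabla^2f(x)>0$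 for all $x\ne0$. The polar subdifferential at $x\in\mathrm{dom}(f)$ is $\partial^\circ f(x)=\{y\in\mathrm{dom}(f^\circ): f^\circ(y)f(x)=\langle x,y\rangle-1\}$. If it is a single point $\{y\}$, $f$ is called polar differentiable at $x$ and $\nabla^\circ f(x)=y$. (Functions in $\mathcal S_1(\mathbb R^n)$ are polar differentiable at every $x\ne0$.) A function $g$ is linear on $[0,w]$ if it is finite there and $g(sw)=s\,g(w)$ for all $s\in[0,1]$. Matrix conventions: points $x$ in the domain of $f$ are column vectors and points $y$ in the domain of $f^\circ$ are row vectors; accordingly $\nabla f(x)$ is a row vector and $\nabla f^\circ(y)$ is a column vector, so $xy$, $x\nabla f(x)$ and $\nabla f^\circ(y)y$ are $n\times n$ matrices. $I$ is the identity matrix. *)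

(* Defs.v *)
From HB Require Import structures.
From mathcomp Require Export all_boot all_order all_algebra.
From mathcomp Require Export all_classical all_reals all_analysis.
Export Order.TTheory GRing.Theory Num.Theory.
Export numFieldNormedType.Exports.

Set Implicit Arguments.
Unset Strict Implicit.
Unset Printing Implicit Defensive.

Local Open Scope classical_set_scope.
Local Open Scope ring_scope.

(* Points of the primal space R^n are column vectors ['cV_n] and points of the
   dual space are row vectors ['rV_n], so [y *m x] is the scalar product as a
   1 x 1 matrix and [x *m y] is the n x n matrix xy. *)
Definition pairing (R : realType) (n : nat) (x : 'cV[R]_n) (y : 'rV[R]_n) : R :=
  (y *m x) 0 0.

Section ExtendedRealFunctions.
Context {R : realType}.
Local Open Scope ereal_scope.

(* Meaningful for functions that avoid -oo; the library convention
   0 * +oo = 0 makes the endpoint cases t = 0, 1 trivial. *)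
Definition econvex (V : lmodType R) (g : V -> \bar R) : Prop :=
  forall (u v : V) (t : R), (0 <= t <= 1)%R ->
    g (t *: u + (1 - t) *: v)%R <= t%:E * g u + (1 - t)%:E * g v.

Definition strictly_econvex (V : lmodType R) (g : V -> \bar R) : Prop :=
  forall (u v : V) (t : R), u != v -> (0 < t < 1)%R ->
    g (t *: u + (1 - t) *: v)%R < t%:E * g u + (1 - t)%:E * g v.

Definition edom (V : Type) (g : V -> \bar R) : set V := [set v | g v < +oo].

Definition linear_on_segment (V : lmodType R) (g : V -> \bar R) (w : V) : Prop :=
  (forall s : R, (0 <= s <= 1)%R -> g (s *: w)%R \is a fin_num) /\
  (forall s : R, (0 <= s <= 1)%R -> g (s *: w)%R = s%:E * g w).

End ExtendedRealFunctions.

Section Derivatives.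
Context {R : realType}.

(* The gradient has the transposed shape of its argument: it is a row vector for
   a function of a column vector, and a column vector for a function of a row
   vector. *)
Definition grad (p q : nat) (g : 'M[R]_(p, q) -> R) (z : 'M[R]_(p, q)) :
    'M[R]_(q, p) :=
  \matrix_(i < q, j < p) 'D_(delta_mx j i) g z.

Definition hess_col (n : nat) (g : 'cV[R]_n -> R) (x : 'cV[R]_n) : 'M[R]_n :=
  \matrix_(i < n, j < n) 'D_(delta_mx j 0) (fun z => grad g z 0 i) x.

Definition hess_row (n : nat) (g : 'rV[R]_n -> R) (y : 'rV[R]_n) : 'M[R]_n :=
  \matrix_(i < n, j < n) 'D_(delta_mx 0 j) (fun z => grad g z i 0) y.

(* Finite and differentiable on a neighbourhood of z, with a gradient map that is
   (Frechet) differentiable at z. *)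
Definition twice_differentiable_at (p q : nat) (g : 'M[R]_(p, q) -> \bar R)
    (z : 'M[R]_(p, q)) : Prop :=
  (\forall u \near z, g u \is a fin_num /\ differentiable (fine \o g) u) /\
  differentiable (grad (fine \o g)) z.

Definition posdef_mx (n : nat) (A : 'M[R]_n) : Prop :=
  A^T = A /\ forall v : 'cV[R]_n, v != 0 -> 0 < (v^T *m A *m v) 0 0.

End Derivatives.

Section Polarity.
Context {R : realType} {n : nat}.
Implicit Types (f : 'cV[R]_n -> \bar R) (x : 'cV[R]_n) (y : 'rV[R]_n).

Definition Cvx0 f : Prop :=
  [/\ forall x, (0 <= f x)%E, econvex f, lower_semicontinuous f & f 0 = 0%E].

(* With 0 * +oo = 0, c = 0 is admissible only if <x, y> <= 1 even where f x = +oo;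
   the convention 0 * +oo = +oo gives the same infimum. *)
Definition polar f y : \bar R :=
  ereal_inf [set c%:E | c in [set c : R | 0 <= c /\
    forall x, ((pairing x y)%:E <= 1 + c%:E * f x)%E]].

Definition polar_subdiff f x : set 'rV[R]_n :=
  [set y | [/\ edom f x, edom (polar f) y &
               (polar f y * f x = (pairing x y - 1)%:E)%E]].

(* f is polar differentiable at x, with polar gradient y. *)
Definition is_polar_grad f x y : Prop := polar_subdiff f x = [set y].

Definition S1 f : Prop :=
  [/\ Cvx0 f, forall x, f x \is a fin_num, strictly_econvex f &
      forall x, x != 0 ->
        differentiable (fine \o f) x /\ {for x, continuous (grad (fine \o f))}].

Definition S2 f : Prop :=
  [/\ S1 f,
      forall x, x != 0 ->
        differentiable (grad (fine \o f)) x /\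
        {for x, continuous (hess_col (fine \o f))} &
      forall x, x != 0 -> posdef_mx (hess_col (fine \o f) x)].

End Polarity.

(* Main.v *)
(* Call (x, y, c) a contact triple if h(z) = 1 + c F(z) - <z, y> is nonnegative
   and vanishes at x; then c = F^o(y). Stationarity of h at x gives
   y = c grad F(x) and 1/c = <x, grad F(x)> - F(x), so y = T(x) for an explicit
   differentiable T. Since h is strictly convex, x is its only zero, and by
   compactness every y' near y has a contact point x' near x. Comparing the
   inequalities at two contact triples (envelope argument) gives
   grad F^o(y) = x / F(x). Hence grad F^o is Q(z) = z / F(z) composed with a
   local inverse of T, and its differential is dQ composed with the inverse of
   dT, where dT is c (I - xy)^T (Hess F) up to transposition and dQ is
   (I - xy)^-1 / F(x). *)
Require Import Defs.
From HB Require Import structures.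
From mathcomp Require Import all_boot all_order all_algebra.
From mathcomp Require Import all_classical all_reals all_analysis.
From mathcomp Require Import lra ring.
Import Order.TTheory GRing.Theory Num.Theory.
Import numFieldNormedType.Exports.

Set Implicit Arguments.
Unset Strict Implicit.
Unset Printing Implicit Defensive.

Local Open Scope classical_set_scope.
Local Open Scope ring_scope.

(** * Differentials and continuity for matrix-valued maps *)

Section Differentials.
Context {R : realType}.

Lemma diff_bound (V W : normedModType R) (f df : V -> W) (x : V) :
  is_diff x f df ->
  forall e : R, 0 < e ->
    \forall z \near x, `|f z - f x - df (z - x)| <= e * `|z - x|.
Proof.
case=> fx dfE e e0.
have /diff_locally/eqaddoP/(_ e e0) := fx; rewrite dfE => near0.
rewrite (near_shift 0); apply: filterS near0 => z /=.
by rewrite !fctE/= subr0 addrK opprD addrA.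
Qed.

(** Continuity of [df] is what lets [diff_unique] identify it with the differential. *)
Lemma is_diff_bound (V W : normedModType R) (f : V -> W)
    (df : {linear V -> W}) (x : V) :
  continuous df ->
  (forall e : R, 0 < e ->
    \forall z \near x, `|f z - f x - df (z - x)| <= e * `|z - x|) ->
  is_diff x f df.
Proof.
move=> cdf bnd.
have fo : f \o shift x = cst (f x) + df +o_ 0 id.
  apply/eqaddoP => e e0; have nearx := bnd e e0.
  rewrite (near_shift 0) in nearx; apply: filterS nearx => z /=.
  by rewrite !fctE/= subr0 addrK opprD addrA.
have dfE := diff_unique cdf fo.
by split=> //; apply/diff_locallyP; rewrite dfE.
Qed.

Lemma mx_norm_trmx (m n : nat) (A : 'M[R]_(m, n)) : `|A^T| = `|A|.
Proof.
suff le_trmx p q (B : 'M[R]_(p, q)) : `|B^T| <= `|B|.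
  by apply/le_anti; rewrite le_trmx -{1}[A]trmxK le_trmx.
rewrite /Num.Def.normr/= !mx_normrE; apply: bigmax_le => [|[i j] _] /=.
  by apply/bigmax_geP; left.
by rewrite mxE; exact: (le_bigmax _ (fun ij => `|B ij.1 ij.2|) (j, i)).
Qed.

Lemma mx_norm_coef (m n : nat) (A : 'M[R]_(m, n)) i j : `|A i j| <= `|A|.
Proof.
rewrite [leRHS]/Num.Def.normr/= mx_normrE.
exact: (le_bigmax _ (fun ij => `|A ij.1 ij.2|) (i, j)).
Qed.

Lemma mx_norm_mulmx (m n p : nat) (A : 'M[R]_(m, n)) (B : 'M[R]_(n, p)) :
  `|A *m B| <= n%:R * (`|A| * `|B|).
Proof.
rewrite [leLHS]/Num.Def.normr/= mx_normrE; apply: bigmax_le => [|[i j] _] /=.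
  by rewrite !mulr_ge0.
rewrite mxE (le_trans (ler_norm_sum _ _ _))//.
have le_term (k : 'I_n) : true -> `|A i k * B k j| <= `|A| * `|B|.
  by rewrite normrM ler_pM ?mx_norm_coef.
by rewrite (le_trans (ler_sum _ le_term))// sumr_const card_ord mulr_natl.
Qed.

Lemma cvg_mx (T : Type) (F : set_system T) (m n : nat)
    (M : T -> 'M[R]_(m, n)) (A : 'M[R]_(m, n)) :
  Filter F -> (forall i j, M t i j @[t --> F] --> A i j) ->
  M t @[t --> F] --> A.
Proof.
move=> FF cvgM; apply/cvgrPdist_le => e e0; near=> t.
rewrite [leLHS]/Num.Def.normr/= mx_normrE; apply: bigmax_le => [|ij _] /=.
  exact: ltW.
rewrite !mxE; move: ij; near: t; apply: filter_forall => -[i j] /=.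
by have /cvgrPdist_le := cvgM i j; apply.
Unshelve. all: by end_near. Qed.

Lemma cvg_mulmx (T : Type) (F : set_system T) (m n p : nat)
    (M : T -> 'M[R]_(m, n)) (N : T -> 'M[R]_(n, p))
    (A : 'M[R]_(m, n)) (B : 'M[R]_(n, p)) :
  Filter F -> M t @[t --> F] --> A -> N t @[t --> F] --> B ->
  M t *m N t @[t --> F] --> A *m B.
Proof.
move=> FF cvgM_ cvgN_; apply: cvg_mx => i j /=.
rewrite mxE; under eq_fun do rewrite mxE.
have addc : continuous (fun q : R * R => q.1 + q.2).
  by move=> q; exact: add_continuous.
apply: (cvg_big addc) => k _; apply: cvgM => /=.
  exact: (cvg_comp _ _ cvgM_ (@coord_continuous _ _ _ i k A)).
exact: (cvg_comp _ _ cvgN_ (@coord_continuous _ _ _ k j B)).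
Qed.

Lemma mulmx_continuous (m n p : nat) :
  continuous (fun q : 'M[R]_(m, n) * 'M[R]_(n, p) => q.1 *m q.2).
Proof.
by move=> [A B]; apply: cvg_mulmx; [exact: cvg_fst|exact: cvg_snd].
Qed.

Lemma trmx_continuous (m n : nat) : continuous (@trmx R m n).
Proof.
move=> A; apply: (@cvg_mx _ (nbhs A)) => i j.
rewrite mxE; under eq_fun do rewrite mxE.
exact: coord_continuous.
Qed.

(** Heine-Borel for row vectors, transported by transposition, which is continuous and preserves the
    norm. *)
Lemma bounded_closed_compact_cV (n : nat) (A : set 'cV[R]_n) :
  bounded_set A -> closed A -> compact A.
Proof.
move=> bA cA.
have -> : A = trmx @` (trmx @^-1` A : set 'rV_n).
  apply/seteqP; split=> [z Az|z [w /= Aw <-]//].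
  by exists z^T; rewrite /= trmxK.
apply: continuous_compact; first exact/continuous_subspaceT/trmx_continuous.
apply: bounded_closed_compact.
  case: bA => M [Mreal bM]; exists M; split=> // N MN z /= Az.
  by rewrite -mx_norm_trmx; exact: bM Az.
by apply: preimage_closed => // z _; exact: trmx_continuous.
Qed.

Lemma mulmxl_continuous (m n p : nat) (A : 'M[R]_(m, n)) :
  continuous (mulmx A : 'M[R]_(n, p) -> _).
Proof.
move=> B; apply: (@cvg_mulmx _ (nbhs B) _ _ _ (cst A) id A B).
  exact: cvg_cst.
exact: cvg_id.
Qed.

(** Multiplication is a continuous bilinear map, so this is the chain rule for its composition with
    the pair [(A, B)]. *)
Lemma is_diff_mulmx (V : normedModType R) (m n p : nat)
    (A dA : V -> 'M[R]_(m, n)) (B dB : V -> 'M[R]_(n, p)) (x : V) :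
  is_diff x A dA -> is_diff x B dB ->
  is_diff x (fun z => A z *m B z) (fun v => dA v *m B x + A x *m dB v).
Proof.
move=> dAx dBx.
pose mul := fun q : 'M[R]_(m, n) * 'M[R]_(n, p) => q.1 *m q.2.
have dmul : is_diff (A x, B x) mul (fun q => A x *m q.2 + q.1 *m B x).
  split; first exact/differentiable_bilin/mulmx_continuous.
  by rewrite diff_bilin//; exact: mulmx_continuous.
have -> : (fun z => A z *m B z) = mul \o (fun z => (A z, B z)) by [].
by apply: is_diff_eq; apply/funext => v /=; rewrite addrC.
Qed.

Lemma is_diff_scalemx (V : normedModType R) (m n : nat)
    (k dk : V -> R) (A dA : V -> 'M[R]_(m, n)) (x : V) :
  is_diff x k dk -> is_diff x A dA ->
  is_diff x (fun z => k z *: A z) (fun v => dk v *: A x + k x *: dA v).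
Proof.
move=> dkx dAx.
(* Scaling by [k z] is multiplication by the scalar matrix [k z *: 1%:M], so the product rule
   applies. *)
have dK : is_diff x (fun z => k z *: (1%:M : 'M[R]_m)) (fun v => dk v *: 1%:M).
  by split; [exact: differentiableZl|rewrite diffZl// diff_val].
have := is_diff_mulmx dK dAx.
rewrite (_ : (fun z => _ *m _) = (fun z => k z *: A z)); last first.
  by apply/funext => z; rewrite -scalemxAl mul1mx.
move=> dKA; apply: is_diff_eq; apply/funext => v.
by rewrite -!scalemxAl !mul1mx.
Qed.

(* The inverse function theorem without its existence part: local preimages
   under [T] converging to [x] are given. *)
Lemma is_diff_local_inverse (V W Z : normedModType R) (T dT : V -> W)
    (Q : V -> Z) (dQ : {linear V -> Z}) (S : {linear W -> V})
    (g : W -> Z) (x : V) :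
  is_diff x T dT -> is_diff x Q dQ -> continuous S -> cancel dT S ->
  g (T x) = Q x ->
  (forall e : R, 0 < e -> \forall y \near T x,
    exists z, [/\ `|z - x| < e, T z = y & g y = Q z]) ->
  is_diff (T x) g (dQ \o S).
Proof.
move=> dTx dQx cS dTK gTx sel.
have cQ : continuous dQ.
  by have [/diff_continuous + dQE] := dQx; rewrite dQE.
have [b b0 bQ] := linear_lipschitz cQ.
have [c c0 cSb] := linear_lipschitz cS.
apply: is_diff_bound => [w|e e0].
  by apply: continuous_comp; [exact: cS|exact: cQ].
(* Here [b] and [c] are Lipschitz constants of [dQ] and [S]. The second bound gives [c * h <= 1/2],
   which controls [u] by [w] below; the first keeps the final error within [e] times the norm of
   [w]. *)
pose h := Order.min (e / (2 * c * (1 + b * c))) (2 * c)^-1.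
have bc0 : 0 < 1 + b * c by rewrite addr_gt0// mulr_gt0.
have h0 : 0 < h by rewrite lt_min divr_gt0 ?invr_gt0 ?mulr_gt0.
have he : 2 * c * (1 + b * c) * h <= e.
  by rewrite mulrC -ler_pdivlMr ?mulr_gt0// ge_min lexx.
have hc : 2 * (c * h) <= 1.
  by rewrite mulrA mulrC -ler_pdivlMr ?mulr_gt0// ge_min mul1r lexx orbT.
have /nbhs_ballP[d d0 dball] : \forall z \near x,
    `|T z - T x - dT (z - x)| <= h * `|z - x| /\
    `|Q z - Q x - dQ (z - x)| <= h * `|z - x|.
  by near=> z; split; near: z; [exact: diff_bound|exact: diff_bound].
apply: filterS (sel d d0) => y [z [zx Tz gz]].
have /dball[] : ball x d z by rewrite -ball_normE/= distrC.
rewrite gz gTx -{}Tz.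
set u := z - x; set w := T z - T x => Tu Qu.
(* As [S] inverts [dT], [u - S w] is [S (dT u - w)], the image of the first-order error of [T]. *)
have uSw : `|u - S w| <= c * h * `|u|.
  rewrite -[u in u - _]dTK -linearB (le_trans (cSb _))// -mulrA ler_pM2l//.
  by rewrite distrC.
(* The error is at most half the norm of [u], so it can be absorbed on the left. *)
have uw : `|u| <= 2 * c * `|w|.
  have : `|u| <= `|u - S w| + c * `|w|.
    rewrite -[u in leLHS](subrK (S w)) (le_trans (ler_normD _ _))// lerD2l.
    exact: cSb.
  have : 2 * (c * h) * `|u| <= `|u| by rewrite -[leRHS]mul1r ler_wpM2r.
  by lra.
have -> : Q z - Q x - (dQ \o S) w = (Q z - Q x - dQ u) + dQ (u - S w).
  by rewrite [dQ (u - _)]linearB addrA subrK.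
have le1 : b * `|u - S w| <= b * (c * h * `|u|) by rewrite ler_pM2l.
have le2 : (1 + b * c) * h * `|u| <= (1 + b * c) * h * (2 * c * `|w|).
  by rewrite ler_wpM2l// mulr_ge0// ltW.
have le3 : 2 * c * (1 + b * c) * h * `|w| <= e * `|w| by rewrite ler_wpM2r.
rewrite (le_trans (ler_normD _ _))// (le_trans (lerD Qu (bQ _)))//.
by lra.
Unshelve. all: by end_near. Qed.

End Differentials.

(** * Gradients and Hessians as matrices of differentials *)

Section Gradients.
Context {R : realType}.

(** Expand [v] in the matrix units; since the gradient is stored transposed, the sum of products of
    entries becomes a trace. *)
Lemma diff_grad (p q : nat) (g : 'M[R]_(p, q) -> R) (z v : 'M[R]_(p, q)) :
  differentiable g z -> 'd g z v = \tr (grad g z *m v).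
Proof.
move=> dg; rewrite {1}[v]matrix_sum_delta linear_sum /mxtrace.
under [RHS]eq_bigr do rewrite mxE.
rewrite exchange_big; apply: eq_bigr => i _.
rewrite linear_sum; apply: eq_bigr => j _.
by rewrite linearZ /= mxE deriveE// mulrC.
Qed.

Lemma grad_eq (p q : nat) (g : 'M[R]_(p, q) -> R) (z : 'M[R]_(p, q)) A :
  is_diff z g (fun v => \tr (A *m v)) -> grad g z = A.
Proof.
move=> gz; apply/matrixP => i j; rewrite mxE deriveE ?diff_val// /mxtrace.
rewrite (bigD1 i)//= big1 ?addr0 => [|k ki]; rewrite mxE.
  rewrite (bigD1 j)//= big1 ?addr0 => [|l lj]; rewrite mxE ?eqxx ?mulr1//.
  by rewrite (negPf lj) mulr0.
by rewrite big1// => l _; rewrite mxE (negPf ki) andbF mulr0.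
Qed.

Lemma mxtrace11 (A : 'M[R]_1) : \tr A = A 0 0.
Proof. by rewrite /mxtrace big_ord1. Qed.

Lemma diff_grad_col (n : nat) (g : 'cV[R]_n -> R) x v :
  differentiable g x -> 'd g x v = pairing v (grad g x).
Proof. by move=> dg; rewrite diff_grad// mxtrace11. Qed.

Lemma grad_row_eq (n : nat) (g : 'rV[R]_n -> R) y (p : 'cV[R]_n) :
  is_diff y g (pairing p) -> grad g y = p.
Proof.
move=> gy; apply: grad_eq; apply: is_diff_eq.
by apply/funext => w; rewrite mxtrace_mulC mxtrace11.
Qed.

Lemma diff_hess_col (n : nat) (g : 'cV[R]_n -> R) (x v : 'cV[R]_n) :
  differentiable (grad g) x -> 'd (grad g) x v = (hess_col g x *m v)^T.
Proof.
move=> dg; rewrite {1}[v]matrix_sum_delta linear_sum.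
apply/rowP => i; rewrite summxE !mxE; apply: eq_bigr => j _.
rewrite big_ord1 linearZ !mxE -deriveE// derive_mx; last exact: diff_derivable.
by rewrite mxE mulrC.
Qed.

Lemma hess_row_eq (n : nat) (g : 'rV[R]_n -> R) (y : 'rV[R]_n) (A : 'M[R]_n) :
  is_diff y (grad g) (fun w => A *m w^T) -> hess_row g y = A.
Proof.
move=> gy; apply/matrixP => i j; rewrite mxE.
have := @derive_mx _ _ _ _ (grad g) y (delta_mx 0 j) (diff_derivable _).
move=> /(_ (@ex_diff _ _ _ _ _ _ _ gy))/matrixP/(_ i 0).
rewrite [RHS]mxE => <-; rewrite deriveE// diff_val trmx_delta.
by rewrite -colE mxE.
Qed.

End Gradients.

(** * The pairing and contact triples *)

Section PolarPairs.
Context {R : realType} {n : nat}.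
Implicit Types (x z v : 'cV[R]_n) (y w : 'rV[R]_n).

Lemma pairingDl x z y : pairing (x + z) y = pairing x y + pairing z y.
Proof. by rewrite /pairing mulmxDr mxE. Qed.

Lemma pairingDr x y w : pairing x (y + w) = pairing x y + pairing x w.
Proof. by rewrite /pairing mulmxDl mxE. Qed.

Lemma pairingZl a x y : pairing (a *: x) y = a * pairing x y.
Proof. by rewrite /pairing -scalemxAr mxE. Qed.

Lemma pairingZr a x y : pairing x (a *: y) = a * pairing x y.
Proof. by rewrite /pairing -scalemxAl mxE. Qed.

Lemma pairingBl x z y : pairing (x - z) y = pairing x y - pairing z y.
Proof. by rewrite /pairing mulmxBr !mxE. Qed.

Lemma pairingBr x y w : pairing x (y - w) = pairing x y - pairing x w.
Proof. by rewrite /pairing mulmxBl !mxE. Qed.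

Lemma norm_pairing x y : `|pairing x y| <= n%:R * (`|y| * `|x|).
Proof. exact: le_trans (mx_norm_coef _ _ _) (mx_norm_mulmx _ _). Qed.

Lemma cvg_pairing (T : Type) (F : set_system T) (X : T -> 'cV[R]_n)
    (Y : T -> 'rV[R]_n) x y :
  Filter F -> X t @[t --> F] --> x -> Y t @[t --> F] --> y ->
  pairing (X t) (Y t) @[t --> F] --> pairing x y.
Proof.
move=> FF Xx Yy; have YX := cvg_mulmx FF Yy Xx.
exact: (cvg_comp _ _ YX (@coord_continuous _ _ _ 0 0 _)).
Qed.

(* For [F] positive away from 0 this says that [c] is the polar of [F] at [y]
   and that [y] lies in the polar subdifferential of [F] at [x]. *)
Definition polar_contact (F : 'cV[R]_n -> R) x y (c : R) : Prop :=
  [/\ 0 < c, forall z, pairing z y <= 1 + c * F z & pairing x y = 1 + c * F x].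

(** The contact inequality makes [c] admissible in the infimum; equality at [x], where [f] is
    positive, forces every admissible [d] to be at least [c]. *)
Lemma polar_contactE (f : 'cV[R]_n -> \bar R) x y c :
  (forall z, f z \is a fin_num) -> 0 < fine (f x) ->
  polar_contact (fine \o f) x y c -> polar f y = c%:E.
Proof.
move=> ffin fx0 [c0 cle cx]; apply/le_anti/andP; split.
  apply: ereal_inf_lbound; exists c => //; split; first exact: ltW.
  by move=> z; rewrite -(fineK (ffin z)) -EFinM -EFinD lee_fin; exact: cle.
apply: le_ereal_inf_tmp => _ [d [d0 dle] <-]; rewrite lee_fin.
have := dle x; rewrite -(fineK (ffin x)) -EFinM -EFinD lee_fin cx.
by rewrite lerD2l /= ler_pM2r.
Qed.

Lemma polar_ge0 (f : 'cV[R]_n -> \bar R) y : (0 <= polar f y)%E.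
Proof. by apply: le_ereal_inf_tmp => _ [d [d0 _] <-]; rewrite lee_fin. Qed.

(** The inequality passes from admissible constants to their infimum in the limit, so the infimum is
    itself admissible. *)
Lemma polar_subdiff_contact (f : 'cV[R]_n -> \bar R) x y :
  (forall z, f z \is a fin_num) -> (forall z, (0 <= f z)%E) ->
  polar_subdiff f x y ->
  polar_contact (fine \o f) x y (fine (polar f y)).
Proof.
move=> ffin f0 [_ ydom cx].
have cfin : polar f y \is a fin_num by rewrite ge0_fin_numE ?polar_ge0.
have cxE : pairing x y = 1 + fine (polar f y) * fine (f x).
  have : (polar f y * f x)%E = (pairing x y - 1)%:E := cx.
  rewrite -(fineK cfin) -(fineK (ffin x)) -EFinM => -[->] /=.
  by rewrite addrC subrK.
have cle z : pairing z y <= 1 + fine (polar f y) * fine (f z).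
  have fz0 : 0 <= fine (f z) by exact: fine_ge0.
  apply/ler_addgt0Pr => e e0.
  (* An excess of this size over the infimum costs at most [e] after multiplication by [f z]; the
     [+ 1] covers [f z = 0]. *)
  have d0 : 0 < e / (fine (f z) + 1) by rewrite divr_gt0// ltr_wpDl.
  have [_ [d [_ dle] <-]] := lb_ereal_inf_adherent d0 cfin.
  rewrite -/(polar f y) -[X in (_ < X + _)%E](fineK cfin) -EFinD lte_fin => ltd.
  have := dle z; rewrite -(fineK (ffin z)) -EFinM -EFinD lee_fin /=.
  move/le_trans; apply.
  rewrite -addrA lerD2l.
  have : e / (fine (f z) + 1) * fine (f z) <= e.
    by rewrite mulrAC ler_pdivrMr ?ltr_wpDl// ler_wpM2l ?ltW// ltrDl.
  have := ler_wpM2r fz0 (ltW ltd); lra.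
split => //; rewrite lt_neqAle fine_ge0 ?polar_ge0// andbT eq_sym.
(* If the polar vanished at [y], the pairing of [x] and [y] would be 1, and the inequality at
   [2 *: x] would read [2 <= 1]. *)
apply/eqP => c0; have := cle (2 *: x).
by rewrite pairingZl cxE /= c0 !mul0r addr0; lra.
Qed.

End PolarPairs.

(** [is_diff_bound] expects a bundled linear map, and a pairing will be the differential of the
    polar. *)
HB.instance Definition _ (R : realType) (n : nat) (x : 'cV[R]_n) :=
  GRing.isLinear.Build R 'rV[R]_n R _ (pairing x)
    (fun a y w =>
      etrans (pairingDr _ _ _) (congr1 (+%R^~ _) (pairingZr _ _ _))).

(** * Contact triples of strictly convex functions *)

Section StrictlyConvexContact.
Context {R : realType} {n : nat} (F : 'cV[R]_n -> R).
Implicit Types (x z v : 'cV[R]_n) (y w : 'rV[R]_n).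

Context (F_gt0 : forall z, z != 0 -> 0 < F z)
  (F_strict : forall u v (t : R), u != v -> 0 < t < 1 ->
     F (t *: u + (1 - t) *: v) < t * F u + (1 - t) * F v)
  (F_diff : forall z, z != 0 -> differentiable F z).

(** Equality at a second point [z] would violate the contact inequality at the midpoint of [z] and
    [x], by strict convexity. *)
Lemma polar_contact_lt x y c z :
  polar_contact F x y c -> z != x -> pairing z y < 1 + c * F z.
Proof.
move=> [c0 cle cx] zx.
have half01 : 0 < (2^-1 : R) < 1 by apply/andP; split; lra.
have := F_strict zx half01.
rewrite -(ltr_pM2l c0); have := cle (2^-1 *: z + (1 - 2^-1) *: x).
rewrite pairingDl !pairingZl cx; lra.
Qed.

(** A point of the segment from [x] to [z] close to [x] satisfies the inequality; convexity and
    equality at [x] carry it along the segment to [z]. *)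
Lemma polar_contact_of_local x y c :
  0 < c -> pairing x y = 1 + c * F x ->
  (\forall z \near x, pairing z y <= 1 + c * F z) ->
  polar_contact F x y c.
Proof.
move=> c0 cx /nbhs_ballP[e /= e0 ball_le]; split=> // z.
have [->|zx] := eqVneq z x; first by rewrite cx.
have d0 : 0 < `|z - x| by rewrite normr_gt0 subr_eq0.
(* This [t] lies in (0, 1) and brings the point within [e] of [x], however far [z] is. *)
pose t := e / (e + `|z - x|).
have t0 : 0 < t by rewrite divr_gt0// addr_gt0.
have t1 : t < 1 by rewrite ltr_pdivrMr ?addr_gt0// mul1r ltrDl.
have : ball x e (t *: z + (1 - t) *: x).
  rewrite -ball_normE /= distrC scalerBl scale1r addrCA addrAC subrr add0r.
  rewrite -scalerBr normrZ gtr0_norm// /t mulrAC ltr_pdivrMr ?addr_gt0//.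
  by rewrite ltr_pM2l// ltrDr.
move=> /ball_le; rewrite pairingDl !pairingZl cx => le_u.
have := F_strict zx (introT andP (conj t0 t1)); rewrite -(ltr_pM2l c0) => lt_u.
have : t * pairing z y <= t * (1 + c * F z) by lra.
by rewrite ler_pM2l.
Qed.

(* The maximum of (<z, y'> - 1) / F(z) over a closed ball around [x] is attained
   in the interior as soon as y' is close to y, because for y' = y it is
   attained at [x] only. *)
Lemma polar_contact_near x y c (e : R) :
  x != 0 -> polar_contact F x y c -> 0 < e ->
  \forall y' \near y, exists x' c',
    [/\ `|x' - x| < e, x' != 0 & polar_contact F x' y' c'].
Proof.
move=> x0 xyc e0; have [c0 _ cx] := xyc.
(* Half the norm of [x] keeps the closed ball away from 0, so that [F] is positive and continuous on
   it. *)
pose r := Order.min e (`|x| / 2).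
have normx0 : 0 < `|x| by rewrite normr_gt0.
have r0 : 0 < r by rewrite lt_min e0 divr_gt0.
have neq0 z : `|z - x| <= r -> z != 0.
  apply: contraTneq => ->; rewrite sub0r normrN -ltNge /r gt_min.
  by apply/orP; right; lra.
pose k (q : 'cV[R]_n * 'rV[R]_n) := (F q.1)^-1 * (pairing q.1 q.2 - 1).
have k_cvg T (FF : set_system T) (X : T -> 'cV[R]_n) (Y : T -> 'rV[R]_n) z w :
    Filter FF -> z != 0 -> X t @[t --> FF] --> z -> Y t @[t --> FF] --> w ->
    k (X t, Y t) @[t --> FF] --> k (z, w).
  move=> FFF z0 Xz Yw; apply: cvgM.
    apply: cvgV; first by rewrite gt_eqF ?F_gt0.
    exact: (cvg_comp _ _ Xz (differentiable_continuous (F_diff z0))).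
  by apply: cvgB; [exact: cvg_pairing|exact: cvg_cst].
have k_le z w d : z != 0 -> (k (z, w) <= d) = (pairing z w <= 1 + d * F z).
  move=> z0; rewrite /k mulrC ler_pdivrMr ?F_gt0// lerBlDr.
  by rewrite addrC.
have k_lt z w d : z != 0 -> (k (z, w) < d) = (pairing z w < 1 + d * F z).
  by move=> z0; rewrite /k mulrC ltr_pdivrMr ?F_gt0// ltrBlDr addrC.
have kx : k (x, y) = c.
  by rewrite /k /= cx addrAC subrr add0r mulrC mulfK// gt_eqF// F_gt0.
pose S := [set z : 'cV[R]_n | `|z - x| = r].
have cvgN (z : 'cV[R]_n) : `|z' - x| @[z' --> z] --> `|z - x|.
  apply: (@cvg_norm _ _ _ (nbhs z)).
  by apply: (@cvgB _ _ _ (nbhs z) _ id (cst x)); [exact: cvg_id|exact: cvg_cst].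
have bounded_ball : bounded_set [set z : 'cV[R]_n | `|z - x| <= r].
  exists (r + `|x|); split; first exact: num_real.
  move=> M rM z /= zx; rewrite -[z](subrK x) (le_trans (ler_normD _ _))//.
  by rewrite (le_trans _ (ltW rM))// lerD2r.
have compactK : compact [set z : 'cV[R]_n | `|z - x| <= r].
  apply: bounded_closed_compact_cV => //.
  have := @preimage_closed _ _ (fun z : 'cV[R]_n => `|z - x|) [set u : R | u <= r].
  by apply; [move=> z _; exact: cvgN|exact: closed_le].
have compactS : compact S.
  apply: (subclosed_compact _ compactK); last by move=> z /= ->.
  have := @preimage_closed _ _ (fun z : 'cV[R]_n => `|z - x|) [set u : R | u = r].
  by apply; [move=> z _; exact: cvgN|exact: closed_eq].
(* The strict inequality holds at [y] with value [c] on the right; compactness of the sphere makes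
   one neighbourhood of [y] serve all [z]. *)
have nearS : \forall y' \near y, S `<=` (fun z => k (z, y') < k (x, y')).
  have cover := (compact_near_coveringP S).1 compactS.
  apply: (cover _ (nbhs y) (fun y' z => k (z, y') < k (x, y'))) => z Sz.
  have z0 : z != 0 by apply: neq0; rewrite Sz.
  have : k (q.1, q.2) - k (x, q.2) @[q --> (nbhs z, nbhs y)] -->
         k (z, y) - k (x, y).
    apply: cvgB.
      by apply: (@k_cvg _ _ fst snd z y) => //; [exact: cvg_fst|exact: cvg_snd].
    apply: (@k_cvg _ _ (cst x) snd x y) => //; first exact: cvg_cst.
    exact: cvg_snd.
  move/cvgr_lt => /(_ 0); rewrite subr_lt0 kx k_lt//.
  have zx : z != x by rewrite -subr_eq0 -normr_eq0 Sz gt_eqF.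
  move=> /(_ (polar_contact_lt xyc zx)).
  by apply: filterS => q; rewrite subr_lt0.
have nearx : \forall y' \near y, 0 < k (x, y').
  have : k (x, w) @[w --> y] --> k (x, y).
    by apply: (@k_cvg _ (nbhs y) (cst x) id x y) => //; exact: cvg_cst.
  by move/cvgr_gt; apply; rewrite kx.
near=> y'.
have Sy' : S `<=` (fun z => k (z, y') < k (x, y')) by near: y'.
have kxy' : 0 < k (x, y') by near: y'.
have [] := @compact_EVT_max _ _ (fun z => k (z, y')) _ _ compactK.
- by exists x => /=; rewrite subrr normr0 ltW.
- apply: continuous_in_subspaceT => z; rewrite inE /= => zx.
  apply: (@k_cvg _ (nbhs z) id (cst y') z y'); first exact: neq0.
    exact: cvg_id.
  exact: cvg_cst.
move=> x'; rewrite inE /= => x'r maxk.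
have kxx' : k (x, y') <= k (x', y').
  by apply: maxk; rewrite inE /= subrr normr0 ltW.
have x'x : `|x' - x| < r.
  rewrite lt_neqAle x'r andbT; apply/eqP => /Sy' /=.
  by rewrite ltNge kxx'.
have x'0 : x' != 0 by exact: neq0.
exists x', (k (x', y')); split => //.
  by rewrite (lt_le_trans x'x)// ge_min lexx.
(* The maximum over the ball exceeds the values on the sphere, so it is interior and gives the
   inequality near [x']; convexity then makes it global. *)
apply: polar_contact_of_local.
- exact: lt_le_trans kxy' kxx'.
- have Fx'0 : F x' != 0 by rewrite gt_eqF ?F_gt0.
  have -> : k (x', y') * F x' = pairing x' y' - 1.
    by rewrite [k _]/(_^-1 * _) /= mulrC mulrA mulfV// mul1r.
  by rewrite addrC subrK.
have /cvgr_lt/(_ _ x'x) := cvgN x'; apply: filterS => z /ltW zr.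
rewrite -k_le; last exact: neq0.
by apply: maxk; rewrite inE.
Unshelve. all: by end_near. Qed.

(** First-order condition: [1 + c * F z - pairing z y] has a minimum at [x]. *)
Lemma polar_contact_grad x y c :
  differentiable F x -> polar_contact F x y c -> y = c *: grad F x.
Proof.
move=> dF [c0 cle cx].
have le_grad v : pairing v y <= c * pairing v (grad F x).
  rewrite -diff_grad_col//; apply/ler_addgt0Pr => e e0.
  have d0 : 0 < e / (c * (`|v| + 1)) by rewrite divr_gt0// mulr_gt0// ltr_wpDl.
  have /nbhs_ballP[r /= r0 Fball] := diff_bound (differentiableP dF) d0.
  pose t := r / (`|v| + 1).
  have t0 : 0 < t by rewrite divr_gt0// ltr_wpDl.
  have /Fball : ball x r (x + t *: v).
    rewrite -ball_normE /= opprD addrA subrr sub0r normrN normrZ gtr0_norm//.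
    by rewrite mulrAC ltr_pdivrMr ?ltr_wpDl// ltr_pM2l// ltrDl.
  rewrite [x + t *: v]addrC addrK normrZ gtr0_norm// linearZ /=.
  move=> /ler_normlW bnd.
  rewrite -[t *: 'd F x v]/(t * _) in bnd.
  have := cle (t *: v + x); rewrite pairingDl pairingZl cx => le1.
  have le2 : c * (e / (c * (`|v| + 1)) * (t * `|v|)) <= t * e.
    have -> : c * (e / (c * (`|v| + 1)) * (t * `|v|)) =
              t * e * (`|v| / (`|v| + 1)).
      field; rewrite gt_eqF//=; apply/eqP; have := normr_ge0 v; lra.
    rewrite ler_piMr ?mulr_ge0 ?ltW// ltr_pdivrMr ?ltr_wpDl//.
    by rewrite mul1r ltrDl.
  have le3 := ler_wpM2l (ltW c0) bnd.
  have : t * pairing v y <= t * (c * 'd F x v + e) by lra.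
  by rewrite ler_pM2l.
(* The one-sided bound at a basis vector and at its negative gives equality of coordinates. *)
apply/rowP => i; have pE (u : 'rV[R]_n) : pairing (delta_mx i 0) u = u 0 i.
  by rewrite /pairing -colE mxE.
apply/le_anti; rewrite mxE -!pE le_grad/=.
have := le_grad (- delta_mx i 0); rewrite -scaleN1r !pairingZl; lra.
Qed.

Lemma is_diff_polar (G : 'rV[R]_n -> R) x y c :
  (forall x' y' c', x' != 0 -> polar_contact F x' y' c' -> G y' = c') ->
  x != 0 -> polar_contact F x y c ->
  is_diff y G (pairing ((F x)^-1 *: x)).
Proof.
move=> GE x0 xyc; have [_ cle cx] := xyc; have Fx0 := F_gt0 x0.
apply: is_diff_bound => [w|e e0].
  apply: (@cvg_pairing _ _ _ (nbhs w) (cst _) id); first exact: cvg_cst.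
  exact: cvg_id.
have : (F z)^-1 *: z @[z --> x] --> (F x)^-1 *: x.
  apply: (@cvgZ _ _ _ (nbhs x) _ (fun z => (F z)^-1) id); last exact: cvg_id.
  apply: cvgV; first by rewrite gt_eqF.
  exact: (differentiable_continuous (F_diff x0)).
(* The denominator absorbs the factor [n] of [norm_pairing] and is positive even for [n = 0]. *)
move=> /cvgrPdist_lt/(_ (e / (n%:R + 1))) => near_p.
have /near_p/nbhs_ballP[d /= d0 ball_p] : 0 < e / (n%:R + 1).
  by rewrite divr_gt0// ltr_wpDl.
apply: filterS (polar_contact_near x0 xyc d0) => y' [x' [c' [x'x x'0 xyc']]].
have [_ cle' cx'] := xyc'; have Fx'0 := F_gt0 x'0.
rewrite (GE _ _ _ x0 xyc) (GE _ _ _ x'0 xyc').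
set p := (F x)^-1 *: x in ball_p *; set p' := (F x')^-1 *: x'.
(* Envelope argument: the inequality of the new triple is tested at [x] here, that of the old triple
   at [x'] in [up]. The two bounds differ by a pairing with [p' - p], which is small. *)
have low : pairing p (y' - y) <= c' - c.
  rewrite /p pairingZl pairingBr mulrC ler_pdivrMr// mulrBl.
  by rewrite cx; have := cle' x; lra.
have up : c' - c <= pairing p' (y' - y).
  rewrite /p' pairingZl pairingBr mulrC ler_pdivlMr// mulrBl.
  by rewrite cx'; have := cle x'; lra.
have : pairing (p' - p) (y' - y) <= e * `|y' - y|.
  rewrite (le_trans (ler_norm _))// (le_trans (norm_pairing _ _))//.
  have : `|p' - p| <= e / (n%:R + 1).
    rewrite distrC ltW//; apply: ball_p.
    by rewrite -ball_normE /= distrC.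
  rewrite ler_pdivlMr ?ltr_wpDl// => le_p.
  rewrite mulrCA mulrC ler_wpM2r//.
  have := normr_ge0 (p' - p); lra.
rewrite pairingBl ger0_norm; lra.
Qed.

End StrictlyConvexContact.

(** * Inverse and determinant of a rank-one perturbation of the identity *)

Section RankOnePerturbation.
Context {R : realType} {n : nat} (x : 'cV[R]_n) (y : 'rV[R]_n).

Lemma mulmx_pairing (m : nat) (A : 'M[R]_(m, 1)) :
  A *m (y *m x) = pairing x y *: A.
Proof. by rewrite [y *m x]mx11_scalar mul_mx_scalar. Qed.

Lemma pairing_mulmx (m : nat) (A : 'M[R]_(1, m)) :
  y *m x *m A = pairing x y *: A.
Proof. by rewrite [y *m x]mx11_scalar mul_scalar_mx. Qed.

(** Sherman-Morrison formula, with [1 - pairing x y = - k]. *)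
Lemma mulmx_rank1_inv (k : R) : k != 0 -> pairing x y = 1 + k ->
  (1%:M - x *m y) *m (1%:M - k^-1 *: (x *m y)) = 1%:M.
Proof.
move=> k0 xy; rewrite mulmxBl mul1mx mulmxBr mulmx1 -scalemxAr.
rewrite mulmxA -[x *m y *m x]mulmxA mulmx_pairing -scalemxAl xy scalerA.
rewrite mulrDr mulr1 mulVf// scalerDl scale1r.
by rewrite opprB addrK subrK.
Qed.

Lemma det_rank1 : \det (1%:M - x *m y) = 1 - pairing x y.
Proof.
(* Both sides are triangular factorizations of [block_mx 1%:M x y 1%:M]. *)
have eqB : block_mx 1%:M 0 y 1%:M *m block_mx 1%:M x 0 (1%:M - y *m x) =
           block_mx (1%:M - x *m y) x 0 1%:M *m block_mx 1%:M 0 y 1%:M.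
  rewrite !mulmx_block !mul1mx !mulmx1 !mul0mx !mulmx0 ?addr0 ?add0r.
  by rewrite addrC !subrK.
have := congr1 determinant eqB.
rewrite !det_mulmx !det_lblock !det_ublock !det1 !mul1r !mulr1 => <-.
by rewrite det_mx11 !mxE eqxx /pairing mxE.
Qed.

End RankOnePerturbation.

(** * Positive definite matrices *)

Section PosDef.
Context {R : realType} {n : nat}.

Lemma posdef_unitmx (A : 'M[R]_n) : posdef_mx A -> A \in unitmx.
Proof.
move=> [_ Apos]; rewrite unitmxE unitfE; apply/negP => /det0P[v v0 vA].
suff /Apos : v^T != 0 by rewrite trmxK vA mul0mx mxE ltxx.
by apply: contra_neq v0 => vT0; rewrite -[v]trmxK vT0 trmx0.
Qed.

Lemma posdef_invmx (A : 'M[R]_n) : posdef_mx A -> posdef_mx (invmx A).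
Proof.
move=> Apd; have Au := posdef_unitmx Apd; have [As Apos] := Apd.
split=> [|v v0]; first by rewrite trmx_inv As.
have := Apos (invmx A *m v); rewrite trmx_mul trmx_inv As.
rewrite !mulmxA mulmxKV//; apply.
by apply: contra_neq v0 => Av0; rewrite -[v](mulKVmx Au) Av0 mulmx0.
Qed.

Lemma posdef_congr (A N : 'M[R]_n) (k : R) :
  posdef_mx A -> N \in unitmx -> 0 < k -> posdef_mx (k *: (N *m A *m N^T)).
Proof.
move=> [As Apos] Nu k0; split=> [|v v0].
  by rewrite linearZ /= !trmx_mul trmxK As mulmxA.
rewrite -scalemxAr -scalemxAl mxE mulr_gt0//.
have := Apos (N^T *m v); rewrite trmx_mul trmxK !mulmxA; apply.
have NTu : N^T \in unitmx by rewrite unitmx_tr.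
by apply: contra_neq v0 => Nv0; rewrite -[v](mulKmx NTu) Nv0 mulmx0.
Qed.

Lemma invmx_eq (A B : 'M[R]_n) : A *m B = 1%:M -> invmx A = B.
Proof.
move=> AB; have [Au _] := mulmx1_unit AB.
by rewrite -[LHS]mulmx1 -AB mulKmx.
Qed.

End PosDef.

(** * Differentials of the normalized gradient [T] and of [Q] *)

Section PolarGradient.
Context {R : realType} {n : nat} (F : 'cV[R]_n -> R) (x : 'cV[R]_n).
Context (dF : differentiable F x) (ddF : differentiable (grad F) x).

(* At a contact point this is the reciprocal of the polar. *)
Definition legendre_gap (z : 'cV[R]_n) : R := pairing z (grad F z) - F z.

Lemma is_diff_grad_col : is_diff x F (fun v => pairing v (grad F x)).
Proof. by split=> //; apply/funext => v; rewrite diff_grad_col. Qed.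

Lemma is_diff_hess_col : is_diff x (grad F) (fun v => (hess_col F x *m v)^T).
Proof. by split=> //; apply/funext => v; rewrite diff_hess_col. Qed.

(** Differentiating the first argument of the pairing yields exactly the differential of [F], which
    cancels. *)
Lemma is_diff_legendre_gap :
  is_diff x legendre_gap (fun v => pairing x (hess_col F x *m v)^T).
Proof.
have dFx := is_diff_grad_col; have dgx := is_diff_hess_col.
have dmul := is_diff_mulmx dgx (is_diff_id x).
have dpair : is_diff x (fun z => pairing z (grad F z))
    (fun v => pairing x (hess_col F x *m v)^T + pairing v (grad F x)).
  have dcoord :
      is_diff (grad F x *m x) (fun A : 'M[R]_1 => A 0 0) (fun A => A 0 0).
    (* The single coordinate is rewritten as a trace, which is a bundled linear map. *)
    have trE : (fun A : 'M[R]_1 => A 0 0) = @mxtrace R 1.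
      by apply/funext => A; rewrite mxtrace11.
    have trc : continuous (@mxtrace R 1).
      by rewrite -trE; exact: coord_continuous.
    by rewrite trE; split; [exact: linear_differentiable|rewrite diff_lin].
  apply: (is_diff_eq (is_diff_comp dmul dcoord)).
  by apply/funext => v; rewrite /= mxE.
apply: (is_diff_eq (is_diffB dpair dFx)).
by apply/funext => v; rewrite !fctE addrK.
Qed.

(** The map is [T]; at a contact point [c *: grad F x] is [y], so the last factor becomes
    [1%:M - x *m y]. *)
Lemma is_diff_normalized_grad c :
  legendre_gap x = c^-1 -> c != 0 ->
  is_diff x (fun z => (legendre_gap z)^-1 *: grad F z)
    (fun v => c *: ((hess_col F x *m v)^T *m (1%:M - x *m (c *: grad F x)))).
Proof.
move=> Lc c0; have dgx := is_diff_hess_col; have dL := is_diff_legendre_gap.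
have L0 : legendre_gap x != 0 by rewrite Lc invr_eq0.
have dV : is_diff x (fun z => (legendre_gap z)^-1)
    (fun v => - c ^+ 2 * pairing x (hess_col F x *m v)^T).
  split; first exact: differentiableV.
  by rewrite diffV// diff_val; apply/funext => v /=; rewrite Lc exprVn invrK.
apply: (is_diff_eq (is_diff_scalemx dV dgx)); apply/funext => v.
rewrite Lc invrK mulmxBr mulmx1 mulmxA pairing_mulmx scalerBr !scalerA.
by rewrite addrC mulNr scaleNr expr2 mulrAC -mulrA [_ * c]mulrC.
Qed.

Lemma is_diff_normalize :
  F x != 0 ->
  is_diff x (fun z => (F z)^-1 *: z)
    (mulmx ((F x)^-1 *: (1%:M - (F x)^-1 *: (x *m grad F x)))).
Proof.
move=> Fx0; have dFx := is_diff_grad_col.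
have dV : is_diff x (fun z => (F z)^-1)
    (fun v => - (F x)^-2 * pairing v (grad F x)).
  split; first exact: differentiableV.
  by rewrite diffV// diff_val; apply/funext => v.
apply: (is_diff_eq (is_diff_scalemx dV (is_diff_id x))); apply/funext => v.
rewrite -scalemxAl mulmxBl mul1mx -scalemxAl -mulmxA mulmx_pairing scalerBr.
by rewrite !scalerA addrC mulNr scaleNr -exprVn expr2.
Qed.

End PolarGradient.

(** * Consequences of strict convexity and of stationarity at a contact point *)

Lemma S1_fine_gt0 (R : realType) (n : nat) (f : 'cV[R]_n -> \bar R) z :
  S1 f -> z != 0 -> 0 < fine (f z).
Proof.
move=> [[f0 _ _ fz] ffin fs _] z0.
have half01 : 0 < (2^-1 : R) < 1 by apply/andP; split; lra.
(* Strict convexity between [z] and 0, where [f] vanishes, puts [f z / 2] strictly above a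
   nonnegative value. *)
have := fs z 0 2^-1 z0 half01.
rewrite fz mule0 adde0 => /(le_lt_trans (f0 _)).
by rewrite -(fineK (ffin z)) -EFinM lte_fin pmulr_rgt0//; case/andP: half01.
Qed.

Lemma S1_fine_strict (R : realType) (n : nat) (f : 'cV[R]_n -> \bar R) u v t :
  S1 f -> u != v -> 0 < t < 1 ->
  fine (f (t *: u + (1 - t) *: v)) < t * fine (f u) + (1 - t) * fine (f v).
Proof.
move=> [_ ffin fs _] uv t01; have := fs u v t uv t01.
rewrite -(fineK (ffin _)) -(fineK (ffin u)) -(fineK (ffin v)).
by rewrite -!EFinM -EFinD lte_fin.
Qed.

Lemma legendre_gap_contact (R : realType) (n : nat) (F : 'cV[R]_n -> R) x y c :
  differentiable F x -> polar_contact F x y c -> legendre_gap F x = c^-1.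
Proof.
move=> dF xyc; have [c0 _ cx] := xyc.
have yE := polar_contact_grad dF xyc.
apply: (mulfI (lt0r_neq0 c0)); rewrite mulfV ?gt_eqF//.
by rewrite /legendre_gap mulrBr -pairingZr -yE cx addrK.
Qed.

(** * Second derivative of the polar *)

Section PolarHessian.
Context {R : realType} {n : nat} (f : 'cV[R]_n -> \bar R).
Context (x : 'cV[R]_n) (y : 'rV[R]_n) (c : R).
Context (hf : S2 f) (x0 : x != 0) (xyc : polar_contact (fine \o f) x y c).

Let F := fine \o f.
Let G := fine \o polar f.
(** At a contact point [pairing x y = 1 + c * F x], so by [mulmx_rank1_inv] this is the inverse of
    [1%:M - x *m y]. *)
Let N := 1%:M - (c * F x)^-1 *: (x *m y).

Let S1f : S1 f. Proof. by case: hf. Qed.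
Let F_gt0 z : z != 0 -> 0 < F z. Proof. exact: S1_fine_gt0. Qed.
Let F_strict u v (t : R) : u != v -> 0 < t < 1 ->
  F (t *: u + (1 - t) *: v) < t * F u + (1 - t) * F v.
Proof. exact: S1_fine_strict. Qed.
Let F_diff z : z != 0 -> differentiable F z.
Proof. by case: S1f => _ _ _ h /h[]. Qed.
Let F_ddiff z : z != 0 -> differentiable (grad F) z.
Proof. by case: hf => _ h _ /h[]. Qed.

Let polarE z w d : z != 0 -> polar_contact F z w d -> polar f w = d%:E.
Proof.
move=> z0; case: S1f => _ ffin _ _; apply: polar_contactE => //.
exact: F_gt0.
Qed.

Let GE z w d : z != 0 -> polar_contact F z w d -> G w = d.
Proof. by move=> z0 zwd; rewrite /G /= (polarE z0 zwd). Qed.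

Let is_diff_G z w d : z != 0 -> polar_contact F z w d ->
  is_diff w G (pairing ((F z)^-1 *: z)).
Proof.
move=> z0 zwd; apply: is_diff_polar zwd => //; exact: GE.
Qed.

Lemma grad_polar_contact z w d : z != 0 -> polar_contact F z w d ->
  grad G w = (F z)^-1 *: z.
Proof. by move=> z0 zwd; apply: grad_row_eq; exact: is_diff_G zwd. Qed.

Let gap_normal z w d : z != 0 -> polar_contact F z w d ->
  (legendre_gap F z)^-1 *: grad F z = w.
Proof.
move=> z0 zwd; rewrite (legendre_gap_contact (F_diff z0) zwd) invrK.
by rewrite -(polar_contact_grad (F_diff z0) zwd).
Qed.

Lemma is_diff_grad_polar :
  is_diff y (grad G)
    (fun w => ((c * F x)^-1 *: (N *m invmx (hess_col F x) *m N^T)) *m w^T).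
Proof.
have [c0 _ cx] := xyc; have Fx0 := F_gt0 x0.
have c_neq0 : c != 0 by rewrite gt_eqF.
have F_neq0 : F x != 0 by rewrite gt_eqF.
have yE := polar_contact_grad (F_diff x0) xyc.
have Hu : hess_col F x \in unitmx.
  by apply: posdef_unitmx; case: hf => _ _; apply.
have dT := is_diff_normalized_grad (F_diff x0) (F_ddiff x0)
  (legendre_gap_contact (F_diff x0) xyc) c_neq0.
rewrite -yE in dT.
have dQ := is_diff_normalize (F_diff x0) F_neq0.
have NE : 1%:M - (F x)^-1 *: (x *m grad F x) = N.
  by rewrite /N yE -scalemxAr scalerA invfM mulrAC mulVf// mul1r.
rewrite NE in dQ.
(* Inverse of the differential of [T], up to transposing its argument: [N^T] undoes the factor
   [(1%:M - x *m y)^T], then the Hessian is inverted. *)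
pose A := c^-1 *: (invmx (hess_col F x) *m N^T).
have yT := gap_normal x0 xyc.
have cS : continuous (mulmx A \o @trmx R 1 n).
  move=> w; apply: continuous_comp; first exact: trmx_continuous.
  exact: mulmxl_continuous.
have cF_neq0 : c * F x != 0 by rewrite mulf_neq0.
have dTK : cancel (fun v => c *: ((hess_col F x *m v)^T *m (1%:M - x *m y)))
    (mulmx A \o @trmx R 1 n).
  move=> v /=; rewrite linearZ /= -scalemxAr /A -scalemxAl scalerA mulfV//.
  rewrite scale1r trmx_mul trmxK !mulmxA -(mulmxA (invmx _)) -trmx_mul.
  by rewrite (mulmx_rank1_inv cF_neq0 cx) trmx1 mulmx1 mulVmx// mul1mx.
have := is_diff_local_inverse (g := grad G) dT dQ cS dTK.
rewrite yT => /(_ (grad_polar_contact x0 xyc)) H.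
have /H{H} : forall e : R, 0 < e -> \forall w \near y, exists z,
    [/\ `|z - x| < e, (legendre_gap F z)^-1 *: grad F z = w
      & grad G w = (F z)^-1 *: z].
  move=> e e0; have := polar_contact_near F_gt0 F_strict F_diff x0 xyc e0.
  apply: filterS => w [z [d [zx z0 zwd]]]; exists z; split => //.
    exact: gap_normal zwd.
  exact: grad_polar_contact zwd.
move=> dG; apply: is_diff_eq; apply/funext => w /=.
by rewrite /A mulmxA -scalemxAr -[_ *: N *m _]scalemxAl scalerA -invfM mulmxA.
Qed.

Lemma twice_differentiable_polar : twice_differentiable_at (polar f) y.
Proof.
split; last by case: is_diff_grad_polar.
(* Every [w] near [y] has its own contact point, so the envelope argument applies at [w] too. *)
have := polar_contact_near F_gt0 F_strict F_diff x0 xyc ltr01.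
apply: filterS => w [z [d [zx z0 zwd]]]; split.
  by rewrite (polarE z0 zwd).
by case: (is_diff_G z0 zwd).
Qed.

Lemma hess_polar :
  hess_row G y = (c * F x)^-1 *: (N *m invmx (hess_col F x) *m N^T).
Proof. exact: hess_row_eq is_diff_grad_polar. Qed.

End PolarHessian.

(** * Assembly of the matrix identities and the determinant formula *)

Theorem proposition4p2 (R : realType) (n : nat) (f : 'cV[R]_n -> \bar R)
    (x : 'cV[R]_n) (y : 'rV[R]_n)
    (hf : S2 f) (hx : x != 0) (hy : is_polar_grad f x y)
    (hlin : ~ linear_on_segment (polar f) y) :
  let F := fine \o f in
  let G := fine \o polar f in
  [/\ twice_differentiable_at (polar f) y,
      posdef_mx (hess_row G y),
      (F x * G y) ^+ 2 *: hess_row G y =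
        ((F x)%:M - x *m grad F x) *m invmx (hess_col F x) *m
        ((G y)%:M - (grad G y *m y)^T),
      invmx (hess_row G y) =
        (F x * G y) *: ((1%:M - x *m y)^T *m hess_col F x *m (1%:M - x *m y)) &
      \det (hess_col F x) * \det (hess_row G y) = 1 / (F x * G y) ^+ (n + 2)].
Proof.
move=> F G.
have [S1f _ Hpos] := hf; have [[f0 _ _ _] ffin _ Fdiff] := S1f.
have Fx0 : 0 < F x by exact: S1_fine_gt0.
have xyc : polar_contact F x y (G y).
  apply: polar_subdiff_contact => //.
  by have := hy; rewrite /is_polar_grad => ->.
have [c0 _ cx] := xyc.
have dF : differentiable F x by case: (Fdiff x hx).
have yE := polar_contact_grad dF xyc.
have HE := hess_polar hf hx xyc.
have gE := grad_polar_contact hf hx xyc.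
set c := G y in c0 cx yE HE xyc *.
set H := hess_col F x in HE *.
have Hpd : posdef_mx H by exact: Hpos.
have Hu := posdef_unitmx Hpd.
have k_gt0 : 0 < c * F x by rewrite mulr_gt0.
have k0 : c * F x != 0 by rewrite gt_eqF.
have MN := mulmx_rank1_inv k0 cx.
set N := 1%:M - (c * F x)^-1 *: (x *m y) in HE MN.
set M := 1%:M - x *m y in MN *.
have [Mu Nu] := mulmx1_unit MN.
split.
- exact: twice_differentiable_polar hf hx xyc.
- rewrite HE; apply: posdef_congr => //; first exact: posdef_invmx.
  by rewrite invr_gt0.
(* Both outer factors are multiples of [N] and [N^T], because [y = c *: grad F x] and
   [grad G y = (F x)^-1 *: x]. *)
- have -> : (F x)%:M - x *m grad F x = F x *: N.
    have coef : F x * ((c * F x)^-1 * c) = 1 by field; rewrite !gt_eqF.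
    rewrite /N [in RHS]yE scalerBr scalemx1 -scalemxAr !scalerA -mulrA.
    by rewrite coef scale1r.
  have -> : c%:M - (grad G y *m y)^T = c *: N^T.
    rewrite gE /N linearB /= trmx1 scalerBr scalemx1 -scalemxAl !linearZ /=.
    by rewrite scalerA invfM mulrA mulfV ?mul1r ?gt_eqF.
  rewrite HE -scalemxAr -!scalemxAl !scalerA; congr (_ *: _).
  by rewrite mulrC [F x * c]mulrC expr2 mulrA mulVf// mul1r.
(* The inner product [N^T *m M^T] is the transpose of [M *m N = 1%:M]; the Hessian then cancels and
   [N *m M] remains. *)
- apply: invmx_eq; rewrite HE -scalemxAl -scalemxAr scalerA [F x * c]mulrC.
  rewrite mulVf// scale1r !mulmxA -(mulmxA _ N^T) -trmx_mul MN trmx1 mulmx1.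
  rewrite mulmxKV//; exact: mulmx1C.
have detN : \det N = - (c * F x)^-1.
  have := congr1 determinant MN; rewrite det_mulmx det1 /M det_rank1 cx.
  rewrite opprD addrA subrr sub0r => detN.
  apply: (mulfI (x := - (c * F x))); first by rewrite oppr_eq0.
  by rewrite detN mulrNN mulfV.
(* The scalar contributes the power [n], and [N] with its transpose contributes the square of
   [\det N], so the sign disappears and the exponent is [n + 2]. *)
rewrite HE detZ !det_mulmx det_tr detN det_inv.
have detH : \det H != 0 by rewrite -unitfE -unitmxE.
rewrite [F x * c]mulrC exprD exprVn.
have kn0 : (c * F x) ^+ n != 0 by rewrite expf_neq0.
by field; rewrite ?kn0 ?detH ?gt_eqF.
Qed.
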